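(* For every real number $a>0$, $$\beta(a) = \frac{1}{2}\left[\psi\left(\frac{a+1}{2}\right) - \psi\left(\frac{a}{2}\right)\right].$$
   Context: The incomplete beta function is the one-variable function defined for real $a>0$ by $\beta(a) = \int_{0}^{1} \frac{x^{a-1}}{1+x}\,dx$ (the integral converges for $a>0$). The digamma function is $\psi(x) = \frac{d}{dx}\log\Gamma(x) = \frac{\Gamma'(x)}{\Gamma(x)}$, where $\Gamma(x) = \int_0^\infty t^{x-1}e^{-t}\,dt$ is the classical gamma function. *)

(* Defs.v *)
From HB Require Import structures.
From mathcomp Require Import all_boot all_order all_algebra.
From mathcomp Require Import all_classical all_reals all_analysis.

Set Implicit Arguments.
Unset Strict Implicit.
Unset Printing Implicit Defensive.

Import Order.TTheory GRing.Theory Num.Theory.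
Import numFieldNormedType.Exports.

Local Open Scope classical_set_scope.
Local Open Scope ring_scope.

(* [Rintegral], [ln] and [derive1] are total: all three functions below carry
   their mathematical meaning for positive arguments only. The intervals are
   open at 0 because [0 `^ p] is 0 for every [p != 0], even for [p < 0]. *)

Definition incomplete_beta (R : realType) (a : R) : R :=
  \int[@lebesgue_measure R]_(x in `]0, 1[) (x `^ (a - 1) / (1 + x)).

Definition Gamma (R : realType) (x : R) : R :=
  \int[@lebesgue_measure R]_(t in `]0, +oo[) (t `^ (x - 1) * expR (- t)).

Definition digamma (R : realType) (x : R) : R :=
  derive1 (fun y : R => ln (Gamma y)) x.

(* Main.v *)
Require Import Defs.
From mathcomp Require Import all_boot all_order all_algebra.
From mathcomp Require Import all_classical all_reals all_analysis.
From mathcomp Require Import measurable_realfun ring lra.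

Import Order.TTheory GRing.Theory Num.Theory.
Import numFieldNormedType.Exports.

Local Open Scope classical_set_scope.
Local Open Scope ring_scope.

(** The identity is proved by uniqueness for a difference equation. Let
    [D a := (psi ((a + 1) / 2) - psi (a / 2)) / 2].  From
    [x^(a-1) / (1+x) + x^a / (1+x) = x^(a-1)] one gets
    [beta a + beta (a + 1) = 1 / a] (lemma [incomplete_beta_add1]), hence
    [beta (a + 2) - beta a = 1 / (a + 1) - 1 / a]; and
    [psi (x + 1) = psi x + 1 / x] (lemma [digamma_add1]) gives the same
    equation for [D].  So the gap [beta a - D a] has period 2.  Both terms are
    [O(1 / a)]: [0 <= beta a <= 1 / a] because of the first equation and
    positivity, and [D a] because [psi x = ln x + O(1 / x)] (lemma
    [digamma_ln_dist]).  A periodic function tending to 0 vanishes.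

    The work lies in showing that [psi] is a genuine derivative and follows the
    logarithm.  Integrating the tangent-line bound
    [t^h <= x^h (h t / x + 1 - h)], for [0 < h < 1], against
    [t^(x-1) e^(-t)] and using [Gamma (x + 1) = x Gamma x] yields Wendel's
    inequality [Gamma (x + h) <= x^h Gamma x] (lemma [Gamma_add_le]).
    Applied once from [x] to [x + h] and once from [x + h] to [x + 1], it pins
    the difference quotients of [ln Gamma] at [x >= 1] to within [3 / x] of
    [ln x], uniformly in small increments (lemma [lnGamma_increment]).
    Since [ln Gamma x = ln Gamma (x + n) - sum_(k < n) ln (x + k)] and the sum
    is differentiable, the difference quotients at [x] oscillate by at most
    [O(1 / (x + n))] near 0, for every [n]; they therefore converge (lemma
    [derivable_lnGamma]).

    The functional equation of [Gamma] and the value of the integral of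
    [x^(a-1)] over the unit interval come from a fundamental theorem of
    calculus on open intervals (lemma [improper_FTC2]). *)

(** * The fundamental theorem of calculus on open intervals *)

(** The integrand [f - g] of the fundamental theorem is split into nonnegative
    parts kept on opposite sides of the equation. Each side then has a limit by
    monotone convergence along the exhausting segments, so neither integral has
    to be known finite: for the gamma function this gives the functional
    equation first, and finiteness is deduced from it. *)
Lemma improper_FTC2 {R : realType} (f g F : R -> R) (u v : nat -> R)
    (l l0 : R) (A : set R) :
  nonincreasing_seq u -> nondecreasing_seq v -> (forall n, u n < v n) ->
  A = \bigcup_n `[u n, v n]%classic ->
  (forall x, A x -> [/\ 0 <= f x, 0 <= g x,
      {for x, continuous f}, {for x, continuous g} &
      is_derive x 1 F (f x - g x)]) ->
  F (u n) @[n --> \oo] --> l0 -> F (v n) @[n --> \oo] --> l ->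
  (\int[lebesgue_measure]_(x in A) (f x)%:E =
   \int[lebesgue_measure]_(x in A) (g x)%:E + (l - l0)%:E)%E.
Proof.
move=> niu ndv uv AE fgF Fu Fv.
have inA n x : `[u n, v n]%classic x -> A x by rewrite AE => ?; exists n.
have mI n : measurable `[u n, v n]%classic by [].
have ndI : nondecreasing_seq (fun n => `[u n, v n]%classic).
  move=> m n mn; apply/subsetPset => x /=; rewrite !in_itv/= => /andP[ux xv].
  by rewrite (le_trans (niu _ _ mn) ux) (le_trans xv (ndv _ _ mn)).
have cf n : {within `[u n, v n], continuous f}.
  by apply: continuous_in_subspaceT => x; rewrite inE => /inA /fgF[].
have cg n : {within `[u n, v n], continuous g}.
  by apply: continuous_in_subspaceT => x; rewrite inE => /inA /fgF[].
have mf n : measurable_fun `[u n, v n]%classic f.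
  by apply: subspace_continuous_measurable_fun.
have mg n : measurable_fun `[u n, v n]%classic g.
  by apply: subspace_continuous_measurable_fun.
have f0 n x : `[u n, v n]%classic x -> (0 <= (f x)%:E)%E by move=> /inA/fgF[].
have g0 n x : `[u n, v n]%classic x -> (0 <= (g x)%:E)%E by move=> /inA/fgF[].
have cvgf := @ge0_nondecreasing_set_cvg_integral _ _ _ _ _ lebesgue_measure
  ndI mI (fun n => (measurable_EFinP _ _).2 (mf n)) f0.
have cvgg := @ge0_nondecreasing_set_cvg_integral _ _ _ _ _ lebesgue_measure
  ndI mI (fun n => (measurable_EFinP _ _).2 (mg n)) g0.
rewrite -AE in cvgf cvgg.
have FTC n : (\int[lebesgue_measure]_(x in `[u n, v n]) (f x)%:E =
    \int[lebesgue_measure]_(x in `[u n, v n]) (g x)%:E +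
    (F (v n) - F (u n))%:E)%E.
  have cF x : `[u n, v n]%classic x -> {for x, continuous F}.
    move=> /inA/fgF[_ _ _ _ [dF _]].
    exact/differentiable_continuous/derivable1_diffP.
  have ku : `[u n, v n]%classic (u n) by rewrite /= in_itv/= lexx ltW.
  have kv : `[u n, v n]%classic (v n) by rewrite /= in_itv/= lexx ltW.
  rewrite EFinB -(@continuous_FTC2 _ (f \- g) F (u n) (v n)) //.
  - rewrite /= -integralD_EFin //=; last 2 first.
    + exact: (@continuous_compact_integrable _ g _ (@segment_compact _ _ _)).
    + apply: (@continuous_compact_integrable _ (f \- g)).
        exact: segment_compact.
      by move=> x; apply: cvgB; [exact: cf|exact: cg].
    by apply: eq_integral => x _; rewrite -EFinD addrC subrK.
  - by move=> x; apply: cvgB; [exact: cf|exact: cg].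
  - split.
    + by move=> x /subset_itv_oo_cc /inA/fgF[_ _ _ _ []].
    + exact/cvg_at_right_filter/cF.
    + exact/cvg_at_left_filter/cF.
  - move=> x /subset_itv_oo_cc /inA/fgF[_ _ _ _ dF].
    by rewrite derive1E derive_val.
apply: (cvg_unique _ cvgf); first exact: ereal_hausdorff.
rewrite /= (eq_cvg _ _ FTC).
apply: cvgeD => //; first by rewrite fin_num_adde_defl.
by apply: cvg_EFin; [exact: nearW|exact: cvgB].
Qed.

(** The points [1 / (n + 2)] serve as left endpoints of exhausting segments:
    they decrease to 0 and are already smaller than 1 at [n = 0]. *)
Lemma harmonic_succ_cvg_at_right {R : realType} (F : R -> R) (l : R) :
  F x @[x --> 0^'+] --> l -> F (n.+2%:R^-1) @[n --> \oo] --> l.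
Proof.
move=> /cvg_at_rightP; apply; split=> [n|]; first by rewrite invr_gt0 ltr0n.
by have := @cvg_harmonic R; rewrite -(cvg_shiftS (@harmonic R)).
Qed.

Lemma harmonic_succ_nonincreasing {R : realType} :
  nonincreasing_seq (fun n => n.+2%:R^-1 : R).
Proof. by move=> m n mn; rewrite lef_pV2 ?posrE// ler_nat. Qed.

Lemma ltr_harmonic_succ {R : realType} (x : R) : 0 < x ->
  exists N, forall n, (N <= n)%N -> n.+2%:R^-1 <= x.
Proof.
move=> x0; exists (Num.trunc x^-1) => n Nn.
rewrite invf_ple ?posrE// (le_trans (ltW (truncnS_gt _)))// ler_nat.
by rewrite ltnS (leq_trans Nn).
Qed.

Lemma improper_FTC2_itvoy {R : realType} (f g F : R -> R) (l l0 : R) :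
  (forall x, 0 < x -> [/\ 0 <= f x, 0 <= g x,
      {for x, continuous f}, {for x, continuous g} &
      is_derive x 1 F (f x - g x)]) ->
  F x @[x --> 0^'+] --> l0 -> F x @[x --> +oo] --> l ->
  (\int[lebesgue_measure]_(x in `]0%R, +oo[) (f x)%:E =
   \int[lebesgue_measure]_(x in `]0%R, +oo[) (g x)%:E + (l - l0)%:E)%E.
Proof.
move=> fgF F0 Fy.
apply: (@improper_FTC2 _ f g F (fun n => n.+2%:R^-1) (fun n => n.+1%:R)).
- exact: harmonic_succ_nonincreasing.
- by move=> m n mn; rewrite ler_nat.
- move=> n; apply: (@lt_le_trans _ _ 1); first by rewrite invf_lt1 ?ltr1n.
  by rewrite ler1n.
- apply/seteqP; split=> x /=.
    rewrite in_itv/= andbT => x0.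
    have [N xN] := ltr_harmonic_succ _ x0.
    exists (maxn N (Num.trunc x)) => //=; rewrite in_itv/= xN ?leq_maxl//=.
    by rewrite (le_trans (ltW (truncnS_gt _)))// ler_nat ltnS leq_maxr.
  move=> [n _] /=; rewrite !in_itv/= andbT => /andP[+ _].
  by apply: lt_le_trans; rewrite invr_gt0 ltr0n.
- by move=> x; rewrite /= in_itv/= andbT; exact: fgF.
- exact: harmonic_succ_cvg_at_right.
- move/cvg_pinftyP : Fy; apply.
  by rewrite (cvg_shiftS (fun n => n%:R : R)); exact: cvgr_idn.
Qed.

Lemma continuous_powR {R : realType} (p x : R) : 0 < x ->
  {for x, continuous (@powR R ^~ p)}.
Proof.
move=> x0; apply/differentiable_continuous/derivable1_diffP.
by case: (is_derive1_powR p x0).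
Qed.

Lemma integral_powR01 {R : realType} (a : R) : 0 < a ->
  (\int[lebesgue_measure]_(x in `]0%R, 1%R[) (x `^ (a - 1))%:E = a^-1%:E)%E.
Proof.
move=> a0.
(* The half-open interval is exhausted by segments sharing the endpoint 1. *)
rewrite -(@integral_itv_bndoo _ _ _ _ false false); last first.
  by apply/measurable_EFinP; exact: measurable_funTS.
have := @improper_FTC2 R (fun x => x `^ (a - 1)) (cst 0)
  (fun x => a^-1 * x `^ a) (fun n => n.+2%:R^-1) (fun=> 1) a^-1 0 `]0, 1].
rewrite integral0 add0e subr0; apply.
- exact: harmonic_succ_nonincreasing.
- by [].
- by move=> n; rewrite invf_lt1 ?ltr1n.
- apply/seteqP; split=> x /=.
    rewrite in_itv/= => /andP[x0 x1].
    have [N xN] := ltr_harmonic_succ _ x0.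
    by exists N => //=; rewrite in_itv/= x1 xN.
  move=> [n _] /=; rewrite !in_itv/= => /andP[+ ->]; rewrite andbT.
  by apply: lt_le_trans; rewrite invr_gt0 ltr0n.
- move=> x; rewrite /= in_itv/= => /andP[x0 _]; split => //.
  + exact: powR_ge0.
  + exact: continuous_powR.
  + exact: cst_continuous.
  + rewrite subr0 -[X in is_derive _ _ _ X](mulKf (lt0r_neq0 a0)).
    by apply: is_deriveZ; exact: is_derive1_powR.
- apply: (@harmonic_succ_cvg_at_right _ (fun x => a^-1 * x `^ a)).
  by rewrite -[X in _ --> X](mulr0 a^-1); apply: cvgMr; exact: powR_cvg0.
- by rewrite powR1 mulr1; exact: cvg_cst.
Qed.

(** * The incomplete beta function *)

Lemma integrable_powR01 {R : realType} (a : R) : 0 < a ->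
  (@lebesgue_measure R).-integrable `]0, 1[ (fun x => (x `^ (a - 1))%:E).
Proof.
move=> a0; apply/integrableP; split.
  by apply/measurable_EFinP; exact: measurable_funTS.
under eq_integral do rewrite gee0_abs ?lee_fin ?powR_ge0//.
by rewrite integral_powR01// ltry.
Qed.

Lemma integrable_beta_integrand {R : realType} (a : R) : 0 < a ->
  (@lebesgue_measure R).-integrable `]0, 1[
    (fun x => (x `^ (a - 1) / (1 + x))%:E).
Proof.
move=> a0; have := integrable_powR01 _ a0; apply: le_integrable => //.
  apply/measurable_EFinP; apply: open_continuous_measurable_fun => //.
  move=> x; rewrite inE/= in_itv/= => /andP[x0 _].
  apply: cvgM; first exact: continuous_powR.
  apply: cvgV; first by rewrite gt_eqF// addr_gt0.
  by apply: cvgD; [exact: cvg_cst|exact: cvg_id].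
move=> x /=; rewrite in_itv/= => /andP[x0 _].
rewrite lee_fin !ger0_norm ?powR_ge0//; last first.
  by rewrite divr_ge0 ?powR_ge0// addr_ge0// ltW.
by rewrite ler_pdivrMr ?addr_gt0// ler_peMr ?powR_ge0// lerDl ltW.
Qed.

Lemma incomplete_beta_ge0 {R : realType} (a : R) : 0 <= incomplete_beta a.
Proof.
apply: Rintegral_ge0 => x /=; rewrite in_itv/= => /andP[x0 _].
by rewrite divr_ge0 ?powR_ge0// addr_ge0// ltW.
Qed.

(** The two integrands add up to [x^(a-1) (1 + x) / (1 + x) = x^(a-1)]. *)
Lemma incomplete_beta_add1 {R : realType} (a : R) : 0 < a ->
  incomplete_beta a + incomplete_beta (a + 1) = a^-1.
Proof.
move=> a0; rewrite /incomplete_beta -RintegralD//; last 2 first.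
  exact: integrable_beta_integrand.
  by apply: integrable_beta_integrand; rewrite addr_gt0.
rewrite -[RHS]/(fine a^-1%:E) -integral_powR01//; apply: eq_Rintegral => x.
rewrite inE/= in_itv/= => /andP[x0 _].
have -> : x `^ (a + 1 - 1) = x `^ (a - 1) * x.
  by rewrite addrAC (@powRD _ x (a - 1) 1) ?(gt_eqF x0) ?implybT// powRr1 ?ltW.
rewrite -mulrDl.
by rewrite -[X in (X + _) / _]mulr1 -mulrDr mulfK// gt_eqF// addr_gt0.
Qed.

Lemma incomplete_beta_le {R : realType} (a : R) : 0 < a ->
  incomplete_beta a <= a^-1.
Proof.
by move=> a0; rewrite -incomplete_beta_add1// lerDl incomplete_beta_ge0.
Qed.

(** * Convergence and functional equation of the gamma integral *)

Lemma is_derive_expRN {R : realType} (x : R) :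
  is_derive x 1 (fun t => expR (- t)) (- expR (- x)).
Proof.
have -> : - expR (- x) = expR (- x) * - 1 by rewrite mulrN1.
apply: (@is_derive1_comp R expR (fun t => - t)).
Qed.

Lemma continuous_expRN {R : realType} : continuous (fun t : R => expR (- t)).
Proof.
move=> x; apply/differentiable_continuous/derivable1_diffP.
by case: (is_derive_expRN x).
Qed.

(** For [t >= 1], with [N + 1] above [p], the series of the exponential gives
    [t^p <= t^(N+1) <= (N+2)! / t * e^t]. *)
Lemma powR_expRN_cvgy {R : realType} (p : R) :
  t `^ p * expR (- t) @[t --> +oo] --> (0 : R).
Proof.
pose N := Num.trunc p.
have inv0 : (N.+2)`!%:R * t^-1 @[t --> +oo] --> (0 : R).
  rewrite -[X in _ --> X](mulr0 (N.+2)`!%:R); apply: cvgMr.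
  apply/gtr0_cvgV0; last exact: cvg_id.
  by near=> t; near: t; exact: nbhs_pinfty_gt.
apply: (squeeze_cvgr _ _ inv0); last exact: cvg_cst.
near=> t.
have t1 : 1 <= t by near: t; exact: nbhs_pinfty_ge.
have t0 : 0 < t by exact: lt_le_trans t1.
rewrite mulr_ge0 ?powR_ge0 ?expR_ge0//= expRN.
rewrite ler_pdivrMr ?expR_gt0//.
rewrite (@le_trans _ _ (t ^+ N.+1))//.
  by rewrite -(powR_mulrn N.+1 (ltW t0)); apply/ler_powR/ltW/truncnS_gt.
have := @expR_ge1Dxn R t N.+1 (ltW t0) => ge.
rewrite (@le_trans _ _ (N.+2`!%:R / t * (t ^+ N.+2 / N.+2`!%:R)))//; last first.
  apply: ler_wpM2l; first by rewrite divr_ge0 ?ler0n// ltW.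
  by rewrite (le_trans _ ge)// ler_wpDl.
have F0 : N.+2`!%:R != 0 :> R by rewrite pnatr_eq0 -lt0n fact_gt0.
rewrite (exprS t N.+1) [leRHS](_ : _ = t ^+ N.+1)//.
move: (_`!%:R) F0 (t ^+ _) => F F0 y; field.
by rewrite F0 gt_eqF.
Unshelve. all: by end_near. Qed.

Definition Gamma_integrand {R : realType} (x t : R) : R :=
  t `^ (x - 1) * expR (- t).

(** Extended-real version of [Gamma], of which [Gamma] is the finite part: it
    can be manipulated before the integral is known to converge. *)
Definition eGamma {R : realType} (x : R) : \bar R :=
  (\int[lebesgue_measure]_(t in `]0%R, +oo[) (Gamma_integrand x t)%:E)%E.

Lemma Gamma_integrand_ge0 {R : realType} (x t : R) : 0 <= Gamma_integrand x t.
Proof. by rewrite mulr_ge0 ?powR_ge0 ?expR_ge0. Qed.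

Lemma continuous_Gamma_integrand {R : realType} (x t : R) : 0 < t ->
  {for t, continuous (Gamma_integrand x)}.
Proof.
by move=> t0; apply: cvgM; [exact: continuous_powR|exact: continuous_expRN].
Qed.

Lemma measurable_Gamma_integrand {R : realType} (x : R) :
  measurable_fun (`]0, +oo[%classic : set R) (Gamma_integrand x).
Proof.
apply: open_continuous_measurable_fun => // t.
by rewrite inE/= in_itv/= andbT; exact: continuous_Gamma_integrand.
Qed.

Lemma eGamma_ge0 {R : realType} (x : R) : (0 <= eGamma x)%E.
Proof.
by apply: integral_ge0 => t _; rewrite lee_fin Gamma_integrand_ge0.
Qed.

Lemma eGamma1 {R : realType} : eGamma (1 : R) = 1%E.
Proof.
have := @improper_FTC2_itvoy R (Gamma_integrand 1) (cst 0)
  (fun t => - expR (- t)) 0 (- 1).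
rewrite integral0 add0e sub0r opprK; apply.
- move=> t t0; split=> //.
  + exact: Gamma_integrand_ge0.
  + exact: continuous_Gamma_integrand.
  + exact: cst_continuous.
  + rewrite subr0 /Gamma_integrand subrr powRr0 mul1r.
    rewrite -[X in is_derive _ _ _ X]opprK.
    by apply: is_deriveN; exact: is_derive_expRN.
- apply: cvgN; apply: cvg_at_right_filter.
  by rewrite -expR0 -[X in expR X]oppr0; exact: continuous_expRN.
- by rewrite -[X in _ --> X]oppr0; apply: cvgN; exact: cvgr_expR.
Qed.

(** Integration by parts: [t^x e^(-t)] vanishes at 0 and at infinity and has
    derivative [x t^(x-1) e^(-t) - t^x e^(-t)]. *)
Lemma eGamma_add1 {R : realType} (x : R) : 0 < x ->
  eGamma (x + 1) = (x%:E * eGamma x)%E.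
Proof.
move=> x0; rewrite /eGamma -ge0_integralZl_EFin//; last 3 first.
- by move=> t _; rewrite lee_fin Gamma_integrand_ge0.
- by apply/measurable_EFinP; exact: measurable_Gamma_integrand.
- exact: ltW.
have := @improper_FTC2_itvoy R (fun t => x * Gamma_integrand x t)
  (Gamma_integrand (x + 1)) (fun t => t `^ x * expR (- t)) 0 0.
rewrite subrr adde0 => H; apply/esym/H => {H}.
- move=> t t0; split.
  + by rewrite mulr_ge0 ?Gamma_integrand_ge0// ltW.
  + exact: Gamma_integrand_ge0.
  + by apply: cvgMr; exact: continuous_Gamma_integrand.
  + exact: continuous_Gamma_integrand.
  + have := is_deriveM (is_derive1_powR x t0) (is_derive_expRN t).
    move=> H; apply: (is_derive_eq H).
    by rewrite /Gamma_integrand addrK/= /GRing.scale/=; ring.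
- rewrite -[X in _ --> X](mul0r (expR (- 0))); apply: cvgM.
    exact: powR_cvg0.
  by apply: cvg_at_right_filter; exact: continuous_expRN.
- exact: powR_expRN_cvgy.
Qed.

Lemma eGamma_nat_lty {R : realType} (n : nat) :
  (eGamma (n.+1%:R : R) < +oo)%E.
Proof.
elim: n => [|n IH]; first by rewrite eGamma1 ltry.
by rewrite -natr1 eGamma_add1// lte_mul_pinfty// lee_fin.
Qed.

(** The functional equation reduces to the argument [x + 1], where
    [t^x <= 1 + t^(N+1)] for a natural number [N + 1] above [x], so that the
    integral is bounded by those at the integers 1 and [N + 2]. *)
Lemma eGamma_lty {R : realType} (x : R) : 0 < x -> (eGamma x < +oo)%E.
Proof.
move=> x0.
suff : (eGamma (x + 1) < +oo)%E.
  rewrite eGamma_add1//; move: (eGamma_ge0 x); case: (eGamma x) => //=.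
    by move=> r _ _; rewrite ltry.
  by rewrite mulry gtr0_sg// mul1e.
have [N xN] : exists N, x <= N.+1%:R.
  by exists (Num.trunc x); exact/ltW/truncnS_gt.
rewrite (@le_lt_trans _ _ (eGamma 1 + eGamma (N.+1.+1%:R))%E)//; last first.
  by apply: lte_add_pinfty; [rewrite eGamma1 ltry|exact: eGamma_nat_lty].
rewrite /eGamma -ge0_integralD//; last 4 first.
- by move=> t _; rewrite lee_fin Gamma_integrand_ge0.
- by apply/measurable_EFinP; exact: measurable_Gamma_integrand.
- by move=> t _; rewrite lee_fin Gamma_integrand_ge0.
- by apply/measurable_EFinP; exact: measurable_Gamma_integrand.
apply: ge0_le_integral => //.
- by move=> t _; rewrite lee_fin Gamma_integrand_ge0.
- by apply/measurable_EFinP; exact: measurable_Gamma_integrand.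
- by apply: emeasurable_funD; apply/measurable_EFinP;
    exact: measurable_Gamma_integrand.
move=> t; rewrite /= in_itv/= andbT => t0.
rewrite -EFinD lee_fin -mulrDl ler_wpM2r ?expR_ge0//.
rewrite addrK subrr powRr0 -natr1 addrK.
have [t1|/ltW t1] := leP 1 t.
  by apply: (@le_trans _ _ (t `^ N.+1%:R)); [exact: ler_powR|rewrite lerDr].
apply: (@le_trans _ _ 1); last by rewrite lerDl powR_ge0.
by rewrite -[leRHS](powRr0 t); apply: ger_powR; [rewrite t0|exact: ltW].
Qed.

Lemma integrable_Gamma_integrand {R : realType} (x : R) : 0 < x ->
  (@lebesgue_measure R).-integrable `]0, +oo[ (EFin \o Gamma_integrand x).
Proof.
move=> x0; apply/integrableP; split.
  by apply/measurable_EFinP; exact: measurable_Gamma_integrand.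
under eq_integral do rewrite /= ger0_norm ?Gamma_integrand_ge0//.
exact: eGamma_lty.
Qed.

Lemma Gamma_add1 {R : realType} (x : R) : 0 < x -> Gamma (x + 1) = x * Gamma x.
Proof.
move=> x0; have := congr1 fine (eGamma_add1 _ x0).
rewrite fineM// ge0_fin_numE ?eGamma_ge0//; exact: eGamma_lty.
Qed.

Lemma Gamma_gt0 {R : realType} (x : R) : 0 < x -> 0 < Gamma x.
Proof.
move=> x0.
suff : (0 < eGamma x)%E by move=> ?; apply: fine_gt0; rewrite eGamma_lty ?andbT.
(* On the segment from 1 to 2 the integrand is at least this constant,
   whatever the sign of the exponent. *)
pose m : R := Num.min 1 (2 `^ (x - 1)) * expR (- 2).
have m0 : 0 < m.
  by rewrite mulr_gt0 ?expR_gt0// lt_min ltr01 powR_gt0.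
rewrite (@lt_le_trans _ _ (\int[lebesgue_measure]_(t in `[1%R, 2%R]) m%:E)%E)//.
  rewrite integral_cst//= lebesgue_measure_itv/= lte_fin ltr1n/= -EFinB -EFinM.
  by rewrite lte_fin; lra.
apply: (@le_trans _ _
    (\int[lebesgue_measure]_(t in `[1%R, 2%R]) (Gamma_integrand x t)%:E)%E).
  apply: ge0_le_integral => //.
  - by move=> t _; rewrite lee_fin ltW.
  - apply/measurable_EFinP.
    apply: measurable_funS (measurable_Gamma_integrand x) => //.
    by move=> t /=; rewrite !in_itv/= andbT => /andP[+ _]; exact: lt_le_trans.
  move=> t /=; rewrite in_itv/= => /andP[t1 t2]; rewrite lee_fin.
  apply: ler_pM; rewrite ?expR_ge0 ?ler_expR ?lerN2//.
  rewrite ge_min; have [x1|/ltW x1] := leP 1 x.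
    by rewrite -[X in X <= _](powRr0 t) ler_powR ?subr_ge0.
  apply/orP; right.
  have -> : x - 1 = - (1 - x) by ring.
  rewrite !powRN lef_pV2 ?posrE ?powR_gt0//; last exact: lt_le_trans t1.
  by rewrite ge0_ler_powR ?nnegrE ?subr_ge0 // (le_trans _ t1).
apply: ge0_subset_integral => //.
- by apply/measurable_EFinP; exact: measurable_Gamma_integrand.
- by move=> t _; rewrite lee_fin Gamma_integrand_ge0.
by move=> t /=; rewrite !in_itv/= andbT => /andP[+ _]; exact: lt_le_trans.
Qed.

(** * Increments of the log-gamma function *)

(** Young's inequality for [t / c] and 1 with weights [h] and [1 - h]: the
    concave function [t^h] lies below its tangent at [c]. *)
Lemma powR_le_tangent {R : realType} (c t h : R) : 0 < c -> 0 <= t ->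
  0 < h < 1 -> t `^ h <= c `^ h * (h / c * t + (1 - h)).
Proof.
move=> c0 t0 /andP[h0 h1].
have k0 : 0 < 1 - h by rewrite subr_gt0.
have Young : (t / c) `^ h <= h * (t / c) + (1 - h).
  have := @conjugate_powR R ((t / c) `^ h) 1 h^-1 (1 - h)^-1
    (powR_ge0 _ _) ler01.
  rewrite !invr_gt0 !invrK mulr1 -powRrM divff ?gt_eqF//.
  rewrite powRr1 ?divr_ge0 ?(ltW c0)// powR1 mul1r (mulrC _ h); apply => //.
  by rewrite addrC subrK.
have {1}-> : t = c * (t / c) by rewrite mulrC divfK// gt_eqF.
rewrite powRM ?divr_ge0 ?(ltW c0)//.
rewrite ler_wpM2l ?powR_ge0// (le_trans Young)// lerD2r.
by rewrite [leRHS]mulrAC mulrA.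
Qed.

(** Wendel's inequality. The tangent bound is integrated with the point of
    tangency [c := x], which is the mean of [t] under the weight
    [t^(x-1) e^(-t)]: the right-hand side then collapses to [x^h Gamma x]. *)
Lemma Gamma_add_le {R : realType} (x h : R) : 0 < x -> 0 < h < 1 ->
  Gamma (x + h) <= x `^ h * Gamma x.
Proof.
move=> x0 h01; have /andP[h0 h1] := h01.
pose k := h / x * x `^ h; pose k' := (1 - h) * x `^ h.
have -> : x `^ h * Gamma x = k * Gamma (x + 1) + k' * Gamma x.
  by rewrite Gamma_add1// /k /k'; field; rewrite gt_eqF.
have IZ (c y : R) : 0 < y -> (@lebesgue_measure R).-integrable `]0, +oo[
    (EFin \o (fun t => c * Gamma_integrand y t)).
  move=> /integrable_Gamma_integrand Iy.
  exact: (integrableZl _ c Iy).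
have x10 := addr_gt0 x0 ltr01.
have I1 := integrable_Gamma_integrand _ x10.
have I0 := integrable_Gamma_integrand _ x0.
rewrite /Gamma -!RintegralZl//.
rewrite -RintegralD//; [|exact: (IZ k _ x10)|exact: (IZ k' _ x0)].
apply: le_Rintegral => //.
- by apply: integrable_Gamma_integrand; rewrite addr_gt0.
- exact: (integrableD _ (IZ k _ x10) (IZ k' _ x0)).
move=> t /=; rewrite in_itv/= andbT => t0.
have tne : t != 0 by rewrite gt_eqF.
rewrite addrK.
have -> : t `^ (x + h - 1) = t `^ (x - 1) * t `^ h.
  by rewrite -powRD ?tne ?implybT// addrAC.
have -> : t `^ x = t `^ (x - 1) * t.
  by rewrite -{1}(subrK 1 x) (@powRD _ t (x - 1) 1) ?tne ?implybT// powRr1// ltW.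
have : 0 <= t `^ (x - 1) * expR (- t) by rewrite mulr_ge0 ?powR_ge0 ?expR_ge0.
have := powR_le_tangent _ _ _ x0 (ltW t0) h01.
rewrite /k /k'; move: (t `^ h) (x `^ h) (t `^ (x - 1)) (expR _) => a b c d ab cd0.
rewrite -subr_ge0 (_ : _ - _ =
  (b * (h / x * t + (1 - h)) - a) * (c * d)); last by ring.
by rewrite mulr_ge0// subr_ge0.
Qed.

Definition lnGamma {R : realType} (x : R) : R := ln (Gamma x).

Lemma lnGamma_add1 {R : realType} (x : R) : 0 < x ->
  lnGamma (x + 1) = lnGamma x + ln x.
Proof.
move=> x0; rewrite /lnGamma Gamma_add1// lnM ?posrE ?Gamma_gt0//.
by rewrite addrC.
Qed.

Lemma lnGamma_add_le {R : realType} (x h : R) : 0 < x -> 0 < h < 1 ->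
  lnGamma (x + h) <= lnGamma x + h * ln x.
Proof.
move=> x0 h01; have /andP[h0 _] := h01.
rewrite /lnGamma -ln_powR [leRHS]addrC -lnM ?posrE ?powR_gt0 ?Gamma_gt0//.
rewrite ler_ln ?posrE ?mulr_gt0 ?powR_gt0 ?Gamma_gt0 ?addr_gt0//.
exact: Gamma_add_le.
Qed.

Lemma ln_sub_le {R : realType} (x h : R) : 0 < x -> 0 <= h ->
  0 <= ln (x + h) - ln x <= h / x.
Proof.
move=> x0 h0; have xh : 0 < x + h by rewrite ltr_wpDr.
rewrite subr_ge0 ler_ln ?posrE// lerDl h0/=.
rewrite -ln_div ?posrE// mulrDl divff ?gt_eqF//.
by apply: le_ln1Dx; rewrite (lt_le_trans (ltrN10 R))// divr_ge0// ltW.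
Qed.

(** Wendel's inequality from [x + h] to [x + 1], with increment [1 - h]. *)
Lemma lnGamma_add_ge {R : realType} (x h : R) : 0 < x -> 0 < h < 1 ->
  lnGamma x + h * ln x - h / x <= lnGamma (x + h).
Proof.
move=> x0 h01; have /andP[h0 h1] := h01.
have xh : 0 < x + h by rewrite addr_gt0.
have : 0 < 1 - h < 1 by rewrite subr_gt0 h1/= ltrBlDr ltrDl.
move=> /(lnGamma_add_le _ _ xh).
rewrite addrA (addrAC x) addrK lnGamma_add1//.
have /andP[l0 l1] := ln_sub_le _ _ x0 (ltW h0).
have := mulr_ge0 (ltW h0) l0.
move: (lnGamma x) (lnGamma _) l0 l1 => a b; move: (ln _) (ln _) => c d.
lra.
Qed.

(** The difference quotient of [lnGamma] at [x] is within [3 / x] of [ln x]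
    uniformly in the increment [h]. This uniformity is what makes both the
    differentiability and the asymptotics of the digamma function work. The
    constant 3 comes from negative [h], where the estimates are centred at
    [x + h >= x / 2] instead of [x]. *)
Lemma lnGamma_increment {R : realType} (x h : R) : 1 <= x -> `|h| <= 2^-1 ->
  `|lnGamma (x + h) - lnGamma x - h * ln x| <= 3 * `|h| / x.
Proof.
move=> x1 h2; have x0 : 0 < x by lra.
have [h0|h0|->] := ltrgtP h 0; last first.
- by rewrite addr0 subrr mul0r subr0 normr0 mulr0 mul0r.
- rewrite gtr0_norm// in h2 *.
  have h01 : 0 < h < 1 by rewrite h0/=; lra.
  have := lnGamma_add_le _ _ x0 h01; have := lnGamma_add_ge _ _ x0 h01.
  have : 0 < h / x by rewrite divr_gt0.
  rewrite -[3 * h / x]mulrA ler_norml.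
  by move: (lnGamma _) (lnGamma _) (ln _) (h / x) => *; apply/andP; split; lra.
rewrite ltr0_norm// in h2 *.
have [k hk] : exists k, h = - k by exists (- h); rewrite opprK.
subst h; rewrite oppr_lt0 in h0; rewrite opprK in h2 *.
have k01 : 0 < k < 1 by rewrite h0/=; lra.
have y0 : 0 < x - k by lra.
have k0 : 0 <= k by exact: ltW.
have := lnGamma_add_le _ _ y0 k01; have := lnGamma_add_ge _ _ y0 k01.
have := ln_sub_le _ _ y0 k0.
rewrite subrK => /andP[l0 l1].
have kl0 := mulr_ge0 k0 l0.
have kl1 := ler_wpM2l k0 l1.
have kx : k / (x - k) <= 2 * (k / x).
  by rewrite ler_pdivrMr// mulrA mulrAC ler_pdivlMr//; nra.
have kk : k * (k / (x - k)) <= 2^-1 * (k / (x - k)).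
  by rewrite ler_wpM2r ?divr_ge0// ltW.
rewrite ler_norml mulNr opprK -[3 * k / x]mulrA.
move: kl0 kl1 kx kk l0 l1.
move: (k / x) (k / (x - k)) => p q.
move: (lnGamma x) (lnGamma _) (ln x) (ln _) => L1 L2 a b *.
by apply/andP; split; lra.
Qed.

(** * The digamma function *)

Lemma lnGamma_addn {R : realType} (x : R) (n : nat) : 0 < x ->
  lnGamma (x + n%:R) = lnGamma x + \sum_(k < n) ln (x + k%:R).
Proof.
move=> x0; elim: n => [|n IH]; first by rewrite addr0 big_ord0 addr0.
rewrite big_ord_recr/= -natr1 addrA lnGamma_add1 ?IH -?addrA//.
by rewrite ltr_wpDr.
Qed.

Lemma derivable_sum_ln {R : realType} (x : R) (n : nat) : 0 < x ->
  derivable (fun y : R => \sum_(k < n) ln (y + k%:R)) x 1.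
Proof.
move=> x0; rewrite (_ : (fun _ => _) =
  \sum_(k < n) (fun y : R => ln (y + k%:R))); last first.
  by apply/funext => y; rewrite fct_sumE.
apply: derivable_sum => k.
have xk : 0 < x + k%:R by rewrite ltr_wpDr.
have dln := is_derive1_ln xk.
have dshift : is_derive x 1 (fun y : R => y + k%:R) 1.
  by rewrite -[X in is_derive _ _ _ X]addr0; exact: is_deriveD.
by have [] := @is_derive1_comp R (@ln R) (fun y => y + k%:R) x _ _ dln dshift.
Qed.

(** With [S] the sum of the [ln (x + k)] for [k < n], the difference quotient
    of [lnGamma] at [x] is the one at [x + n], which stays within
    [3 / (x + n)] of [ln (x + n)], minus that of [S], which converges. As
    [n] is arbitrary, the quotients satisfy the Cauchy criterion. *)
Lemma derivable_lnGamma {R : realType} (x : R) : 0 < x ->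
  derivable (@lnGamma R) x 1.
Proof.
move=> x0; apply: cauchy_cvg; apply: cauchy_exP => e e0.
(* [x + n] above [6 / e] makes the uniform error less than [e / 2]; the other
   half of [e] is spent on the convergence of the quotients of [S]. *)
have [n [X1 Xe]] : exists n, 1 <= x + n%:R /\ 3 / (x + n%:R) < e / 2.
  have e6 : 0 < 6 / e by rewrite divr_gt0.
  exists (Num.trunc (1 + 6 / e)).+1.
  have : 1 + 6 / e < x + (Num.trunc (1 + 6 / e)).+1%:R.
    by rewrite (lt_trans (truncnS_gt _))// ltrDr.
  move: (x + _) => X Xn; split; first lra.
  have X0 : 0 < X by lra.
  rewrite ltr_pdivrMr//.
  have : 6 / e < X by lra.
  by rewrite ltr_pdivrMr//; lra.
pose S y := \sum_(k < n) ln (y + k%:R : R).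
have := derivable_sum_ln x n x0; rewrite -/S => dS.
pose D := lim (h^-1 *: (S (h *: 1 + x) - S x) @[h --> 0^']).
exists (ln (x + n%:R) - D).
have /cvgrPdist_lt/(_ (e / 2)) := dS; rewrite divr_gt0// => /(_ isT) cS.
suff : \forall h \near (0 : R)^', `|ln (x + n%:R) - D -
    h^-1 *: (lnGamma (h *: 1 + x) - lnGamma x)| < e by [].
near=> h.
have h0 : h != 0 by near: h; exact: nbhs_dnbhs_neq.
have hx : `|h| < x.
  by near: h; apply: dnbhs0_lt.
have h2 : `|h| <= 2^-1.
  by near: h; apply: dnbhs0_le; rewrite invr_gt0.
have hS : `|D - h^-1 *: (S (h *: 1 + x) - S x)| < e / 2 by near: h.
have nh : 0 < `|h| by rewrite normr_gt0.
have xh0 : 0 < x + h by move: hx; rewrite ltr_norml => /andP[]; lra.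
have := lnGamma_increment _ _ X1 h2.
have -> : lnGamma (x + n%:R + h) = lnGamma (x + h) + S (x + h).
  by rewrite addrAC lnGamma_addn.
rewrite [lnGamma (x + n%:R)]lnGamma_addn// -/(S x).
move: Xe hS; rewrite /GRing.scale/= mulr1 (addrC h x) mulrAC.
move: (ln _) (3 / _) (lnGamma _) (lnGamma _) (S _) (S _) => l C g g' s s' Ce.
rewrite -ler_pdivrMr// -normfV -normrM.
have -> : (g' + s' - (g + s) - h * l) / h =
  h^-1 * (g' - g) + h^-1 * (s' - s) - l by field.
move: (h^-1 * _) (h^-1 * _) => p q; rewrite !ltr_norml ler_norml.
move=> /andP[? ?] /andP[? ?].
by apply/andP; split; lra.
Unshelve. all: by end_near. Qed.

Lemma is_derive_lnGamma {R : realType} (x : R) : 0 < x ->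
  is_derive x 1 (@lnGamma R) (digamma x).
Proof.
move=> x0; split; first exact: derivable_lnGamma.
rewrite -derive1E /digamma; reflexivity.
Qed.

Lemma digamma_add1 {R : realType} (x : R) : 0 < x ->
  digamma (x + 1) = digamma x + x^-1.
Proof.
move=> x0; have x10 : 0 < x + 1 by rewrite addr_gt0.
have dshift : is_derive x 1 (fun y : R => y + 1) 1.
  by rewrite -[X in is_derive _ _ _ X]addr0; exact: is_deriveD.
have := @is_derive1_comp R lnGamma (fun y => y + 1) x _ _
  (is_derive_lnGamma _ x10) dshift.
rewrite mulr1 => -[_ <-].
have [_ <-] := is_deriveD (is_derive_lnGamma _ x0) (is_derive1_ln x0).
apply: near_eq_derive; near=> y; rewrite /= lnGamma_add1//.
by near: y; exact: lt_nbhsr.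
Unshelve. all: by end_near. Qed.

Lemma digamma_ln_dist {R : realType} (x : R) : 1 <= x ->
  `|digamma x - ln x| <= 3 / x.
Proof.
move=> x1; have x0 : 0 < x by lra.
have dL := derivable_lnGamma _ x0.
apply/ler_addgt0Pr => e e0.
have /cvgrPdist_lt/(_ e e0) cL := dL.
near (0 : R)^' => h.
have h0 : h != 0 by near: h; exact: nbhs_dnbhs_neq.
have h2 : `|h| <= 2^-1.
  by near: h; apply: dnbhs0_le; rewrite invr_gt0.
have hL : `|digamma x - h^-1 *: (lnGamma (h *: 1 + x) - lnGamma x)| < e.
  by near: h; move: cL; rewrite /digamma derive1E.
have nh : 0 < `|h| by rewrite normr_gt0.
have := lnGamma_increment _ _ x1 h2.
move: hL; rewrite /GRing.scale/= mulr1 (addrC h x) mulrAC.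
move: (digamma _) (ln _) (3 / _) (lnGamma _) (lnGamma _) => d l C g g'.
rewrite -ler_pdivrMr// -normfV -normrM.
have -> : (g' - g - h * l) / h = h^-1 * (g' - g) - l by field.
move: (h^-1 * _) => p; rewrite ltr_norml !ler_norml.
move=> /andP[? ?] /andP[? ?].
by apply/andP; split; lra.
Unshelve. all: by end_near. Qed.

(** * Comparison of the two solutions *)

Definition beta_gap {R : realType} (a : R) : R :=
  incomplete_beta a - 1 / 2 * (digamma ((a + 1) / 2) - digamma (a / 2)).

Lemma beta_gap_add2 {R : realType} (a : R) : 0 < a ->
  beta_gap (a + 2) = beta_gap a.
Proof.
move=> a0; rewrite /beta_gap.
have a10 : 0 < a + 1 by rewrite addr_gt0.
have b := incomplete_beta_add1 _ a0; have b1 := incomplete_beta_add1 _ a10.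
have -> : a + 2 = a + 1 + 1 by ring.
have -> : (a + 1 + 1 + 1) / 2 = (a + 1) / 2 + 1 by field.
have -> : (a + 1 + 1) / 2 = a / 2 + 1 by field.
rewrite !digamma_add1 ?divr_gt0// !invf_div.
move: b b1; move: (incomplete_beta _) (incomplete_beta _) (incomplete_beta _).
move: (digamma _) (digamma _) => d d' b2 b1 b0 b01 b12.
have -> : 2 / (a + 1) = 2 * (b1 + b2) by rewrite b12.
have -> : 2 / a = 2 * (b0 + b1) by rewrite b01.
by field.
Qed.

(** With [x := a / 2], the logarithms at [x] and [x + 1 / 2] differ by at most
    [1 / (2 x)], so the two digamma values do by at most [13 / (2 x)]. *)
Lemma beta_gap_le {R : realType} (a : R) : 2 <= a -> `|beta_gap a| <= 8 / a.
Proof.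
move=> a2; have a0 : 0 < a by lra.
pose x := a / 2; have x1 : 1 <= x by rewrite /x; lra.
have x0 : 0 < x by lra.
have y1 : 1 <= x + 2^-1 by lra.
have h0 : (0 : R) <= 2^-1 by lra.
have := digamma_ln_dist _ x1; have := digamma_ln_dist _ y1.
have /andP[] := ln_sub_le _ _ x0 h0.
have := incomplete_beta_ge0 a; have := incomplete_beta_le _ a0.
rewrite /beta_gap -/x.
have -> : (a + 1) / 2 = x + 2^-1 by rewrite /x; field.
have -> : a^-1 = 2^-1 / x by rewrite /x; field; rewrite gt_eqF.
have : 3 / (x + 2^-1) <= 3 / x by rewrite ler_pM2l// lef_pV2 ?posrE; lra.
rewrite !ler_norml.
have : 0 < x^-1 by rewrite invr_gt0.
move: (incomplete_beta _) (3 / (_ + _)) (x^-1) => b q p.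
move: (digamma _) (digamma _) (ln _) (ln _) => *.
by apply/andP; split; lra.
Qed.

(** By periodicity the gap at [a] is the gap at [a + 2 n], which is at most
    [8 / (a + 2 n)]. *)
Lemma beta_gap0 {R : realType} (a : R) : 0 < a -> beta_gap a = 0.
Proof.
move=> a0.
have shift n : beta_gap a = beta_gap (a + 2 * n%:R).
  elim: n => [|n ->]; first by rewrite mulr0 addr0.
  rewrite -(natr1 n) mulrDr mulr1 addrA beta_gap_add2//.
  by rewrite (ltr_wpDr _ a0)// mulr_ge0.
apply/eqP; rewrite -normr_le0; apply/ler_addgt0Pr => e e0; rewrite add0r.
have [n [n1 ne]] : exists n, 1 <= n%:R :> R /\ 4 / e < n%:R.
  exists (Num.trunc (4 / e)).+1; split; first by rewrite ler1n.
  exact: truncnS_gt.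
have n2 : 2 <= a + 2 * n%:R by lra.
rewrite (shift n); apply: (le_trans (beta_gap_le _ n2)).
have n0 : 0 < a + 2 * n%:R by lra.
rewrite ltr_pdivrMr// in ne; rewrite ler_pdivrMr//.
by have := mulr_gt0 a0 e0; nra.
Qed.

Theorem corollary2p2 (R : realType) (a : R) (ha : 0 < a) :
  incomplete_beta a = 1 / 2 * (digamma ((a + 1) / 2) - digamma (a / 2)).
Proof. by apply/eqP; rewrite -subr_eq0; apply/eqP; exact: beta_gap0. Qed.
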